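(* Let $(a,b,c)$ be a Pythagorean triple, and let $(g,h)\in\mathbb{Z}^2$ with $g\neq 0$ and $h\neq 0$. Suppose that for some choice of signs $\varepsilon,\delta\in\{1,-1\}$ (chosen independently of each other) $$(c+\varepsilon a)\,g=(c+\delta b)\,h-1 .$$ Then there exists a path of length $2$ from $(0,0)$ to $(g,h)$ in $\mathcal{G}$.
   Context: $\mathcal{G}$ is the infinite undirected graph with vertex set $V(\mathcal{G})=\mathbb{Z}^2$, in which two vertices $A=(x_1,y_1)$ and $B=(x_2,y_2)$ are joined by an edge if and only if $x_1\neq x_2$, $y_1\neq y_2$, and the Euclidean distance $|AB|=\sqrt{(x_1-x_2)^2+(y_1-y_2)^2}$ is an integer. A path of length $2$ from $A$ to $B$ consists of a vertex $P$ such that $A,P$ are joined by an edge and $P,B$ are joined by an edge. A Pythagorean triple $(a,b,c)$ is a triple of positive integers with $a^2+b^2=c^2$ (not necessarily primitive, and with no ordering imposed on $a,b$). *)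

(* Defs.v *)
From Stdlib Require Import Reals ZArith.

Definition vertex : Type := (Z * Z)%type.

Definition dist (A B : vertex) : R :=
  dist_euc (IZR (fst A)) (IZR (snd A)) (IZR (fst B)) (IZR (snd B)).

Definition is_integer (r : R) : Prop := exists n : Z, r = IZR n.

Definition adjacent (A B : vertex) : Prop :=
  fst A <> fst B /\ snd A <> snd B /\ is_integer (dist A B).

(* No condition A <> P, P <> B is needed: adjacency is irreflexive. *)
Definition path_of_length_2 (A B : vertex) : Prop :=
  exists P : vertex, adjacent A P /\ adjacent P B.

Definition pythagorean_triple (a b c : Z) : Prop :=
  (0 < a /\ 0 < b /\ 0 < c /\ a ^ 2 + b ^ 2 = c ^ 2)%Z.

(* Main.v *)
(** Absorb the signs into [a] and [b], so that [(c + a) g = (c + b) h - 1], and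
    take [P = (- g h a, g h b)].  Then [P] is at distance [|g h| c] from the
    origin, and the hypothesis is exactly what makes
    [|P - (g, h)|^2 = (g - h - g h c)^2].  Since a leg of a Pythagorean triple
    is at least 2, [P] shares no coordinate with [(g, h)]. *)
Require Import Defs.
From Stdlib Require Import Reals ZArith Lia.

(** The distance is the absolute value of [n], so a root of either sign, such as [g * h * c], will
    do. *)
Lemma is_integer_dist (A B : vertex) (n : Z) :
  ((fst A - fst B) ^ 2 + (snd A - snd B) ^ 2 = n ^ 2)%Z ->
  is_integer (Defs.dist A B).
Proof.
  intros H; exists (Z.abs n).
  unfold Defs.dist, dist_euc, Rsqr.
  rewrite <- !minus_IZR, <- !mult_IZR, <- plus_IZR.
  replace (_ + _)%Z with (n * n)%Z by lia.
  now rewrite mult_IZR, abs_IZR; apply sqrt_Rsqr_abs.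
Qed.

(** As [b < c], [a ^ 2 = c ^ 2 - b ^ 2 >= 2 * b + 1 >= 3]; symmetrically for [b]. *)
Lemma pythagorean_leg_ge_2 (a b c : Z) :
  pythagorean_triple a b c -> (2 <= a /\ 2 <= b)%Z.
Proof.
  intros (ha & hb & hc & H).
  assert (a < c /\ b < c)%Z by nia.
  nia.
Qed.

Lemma mul_neq_opp1 (u v : Z) : (2 <= Z.abs u -> v * u <> -1)%Z.
Proof.
  intros Hu H.
  destruct (Z.eq_mul_1 u (- v)); lia.
Qed.

Lemma path_of_signed_triple (a b c g h : Z)
  (ha : (2 <= Z.abs a)%Z) (hb : (2 <= Z.abs b)%Z)
  (habc : (a ^ 2 + b ^ 2 = c ^ 2)%Z)
  (hg : g <> 0%Z) (hh : h <> 0%Z)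
  (hlin : ((c + a) * g = (c + b) * h - 1)%Z) :
  path_of_length_2 (0%Z, 0%Z) (g, h).
Proof.
  exists (- (g * h * a), g * h * b)%Z.
  split; (split; [| split]); cbn [fst snd].
  - nia.
  - nia.
  - apply (is_integer_dist _ _ (g * h * c)); cbn [fst snd].
    transitivity ((g * h) ^ 2 * (a ^ 2 + b ^ 2))%Z; [ring |].
    rewrite habc; ring.
  (* Cancelling [g] in [- (g * h * a) = g] leaves [h * a = -1]; in the next case, cancelling [h]
     leaves [g * b = 1]. *)
  - intros H; apply (mul_neq_opp1 a h ha), (Z.mul_reg_l _ _ g hg); lia.
  - intros H; apply (mul_neq_opp1 (- b) g); [lia |].
    apply (Z.mul_reg_l _ _ h hh); lia.
  - apply (is_integer_dist _ _ (g - h - g * h * c)); cbn [fst snd].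
    (* The two added terms vanish by [habc] and [hlin] respectively. *)
    transitivity ((g - h - g * h * c) ^ 2
      + (g * h) ^ 2 * (a ^ 2 + b ^ 2 - c ^ 2)
      + 2 * g * h * ((c + a) * g - ((c + b) * h - 1)))%Z; [ring |].
    rewrite habc, hlin; ring.
Qed.

Theorem theorem3 (a b c g h : Z)
  (habc : pythagorean_triple a b c)
  (hg : g <> 0%Z) (hh : h <> 0%Z)
  (hsigns : exists eps delta : Z,
     (eps = 1 \/ eps = -1)%Z /\ (delta = 1 \/ delta = -1)%Z /\
     ((c + eps * a) * g = (c + delta * b) * h - 1)%Z) :
  path_of_length_2 (0%Z, 0%Z) (g, h).
Proof.
  destruct (pythagorean_leg_ge_2 a b c habc) as [ha hb].
  destruct habc as (_ & _ & _ & habc).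
  destruct hsigns as (eps & delta & heps & hdelta & hlin).
  apply (path_of_signed_triple (eps * a) (delta * b) c); trivial;
    destruct heps as [-> | ->], hdelta as [-> | ->]; lia.
Qed.
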